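(* Let $\mathcal{C}$ be an $[n,k,d_{\min}]$ linear code with all-symbol locality $r$ for single erasures, i.e., for every coordinate $i \in [n]$ there is a codeword $\mathbf{h} \in \mathcal{C}^\perp$ with $i \in \mathrm{supp}(\mathbf{h})$ and $|\mathrm{supp}(\mathbf{h})| \leq r+1$. Let $$\mathcal{B}_0 = \mathrm{span}\{\mathbf{c} \in \mathcal{C}^{\perp} : |\mathrm{supp}(\mathbf{c})| \leq r+1\}.$$ Let $b = \left\lceil \frac{n}{r+1} \right\rceil$. Then the first $b$ generalized Hamming weights of $\mathcal{B}_0$ are upper bounded by $d_m(\mathcal{B}_0) \leq e_m$, $1 \leq m \leq b$, where $e_m$ is defined recursively by $e_b = n$ and $$e_{m-1} = e_m - \left\lceil \frac{2e_m}{m} \right\rceil + (r+1), \quad 2 \leq m \leq b.$$ Furthermore, if $\ell$ denotes the unique integer such that $e_\ell < k+\ell < e_{\ell+1}$, then the minimum distance of $\mathcal{C}$ is upper bounded by $$d_{\min}(\mathcal{C}) \leq n+1-(k+\ell).$$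
   Context: An $[n,k,d_{\min}]$ code is a $k$-dimensional linear subspace of $\mathbb{F}_q^n$ with minimum Hamming distance $d_{\min}$; $[n]=\{1,\ldots,n\}$; $\mathcal{C}^\perp$ is the dual code of $\mathcal{C}$; $\mathrm{supp}(\mathbf{c})$ is the set of nonzero coordinates of $\mathbf{c}$, and for a code $\mathcal{D}$, $\mathrm{supp}(\mathcal{D}) = \bigcup_{\mathbf{c}\in\mathcal{D}} \mathrm{supp}(\mathbf{c})$. Generalized Hamming weights: for a code $\mathcal{D}$ of dimension $t$ and $1 \le i \le t$, $d_i(\mathcal{D})$ is the minimum of $|\mathrm{supp}(\mathcal{D}')|$ over all $i$-dimensional subcodes $\mathcal{D}'$ of $\mathcal{D}$. *)

(* Defs.v *)
From HB Require Import structures.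
From mathcomp Require Import all_boot all_order all_algebra.

Set Implicit Arguments.
Unset Strict Implicit.
Unset Printing Implicit Defensive.

Import Order.TTheory GRing.Theory.
Local Open Scope ring_scope.

(* The subspaces of F^n are represented by matrices over the finite field F,
   hence there are finitely many of them: this lets minima range over all
   subcodes of a code. *)
HB.instance Definition _ (F : finFieldType) (n : nat) :=
  CanIsCountable (@VectorInternalTheory.vs2mxK F 'rV[F]_n).
HB.instance Definition _ (F : finFieldType) (n : nat) :=
  isFinite.Build {vspace 'rV[F]_n}
    (pcan_enumP (can_pcan (@VectorInternalTheory.vs2mxK F 'rV[F]_n))).

Definition ceil_divn (a d : nat) : nat := (a %/ d + ~~ (d %| a))%N.

Section Codes.
Variables (F : finFieldType) (n : nat).
Implicit Types (x y c : 'rV[F]_n) (C D : {vspace 'rV[F]_n}).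

Definition supp c : {set 'I_n} := [set i | c 0 i != 0].

Definition supp_code D : {set 'I_n} := \bigcup_(c in D) supp c.

Definition hamming_dist x y : nat := #|[set i | x 0 i != y 0 i]|.

(* All Hamming distances are at most n, so the initial value n is harmless
   as soon as C has two distinct codewords; for C = 0 the value is junk. *)
Definition min_dist C : nat :=
  \big[Order.min/n]_(p : 'rV[F]_n * 'rV[F]_n
                      | [&& p.1 \in C, p.2 \in C & p.1 != p.2])
     hamming_dist p.1 p.2.

(* v *m c^T is the 1 x 1 matrix with entry \sum_i v_i c_i; see mem_dual. *)
Definition dual C : {vspace 'rV[F]_n} :=
  (\bigcap_(c in C) lker (linfun (mulmxr c^T)))%VS.

(* Supports have at most n elements, so the initial value n is harmless when
   i <= \dim D; the value is junk otherwise. *)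
Definition ghw D (i : nat) : nat :=
  \big[Order.min/n]_(D' : {vspace 'rV[F]_n} | (D' <= D)%VS && (\dim D' == i))
     #|supp_code D'|.

Definition all_symbol_locality C (r : nat) : Prop :=
  forall i : 'I_n, exists h : 'rV[F]_n,
    [/\ h \in dual C, i \in supp h & (#|supp h| <= r + 1)%N].

Definition low_weight_dual C (r : nat) : {vspace 'rV[F]_n} :=
  <<enum [set c : 'rV[F]_n | (c \in dual C) && (#|supp c| <= r + 1)%N]>>%VS.

Lemma mem_dual C (v : 'rV[F]_n) :
  reflect (forall c, c \in C -> \sum_i v 0 i * c 0 i = 0) (v \in dual C).
Proof.
have scalE c : (v \in lker (linfun (mulmxr c^T)))
    = (\sum_i v 0 i * c 0 i == 0).
  rewrite memv_ker lfunE /=; apply/eqP/eqP => [/matrixP/(_ 0 0)|s0].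
    by rewrite !mxE => {2}<-; apply: eq_bigr => i _; rewrite !mxE.
  apply/matrixP => i j; rewrite !ord1 !mxE -[RHS]s0.
  by apply: eq_bigr => l _; rewrite !mxE.
rewrite memvE; apply: (iffP subv_bigcapP) => vC c cC.
  by apply/eqP; rewrite -scalE memvE vC.
by rewrite -memvE scalE vC.
Qed.

Lemma min_dist_min C x y :
  x \in C -> y \in C -> x != y -> (min_dist C <= hamming_dist x y)%N.
Proof.
move=> xC yC xy.
rewrite /min_dist -leEnat; apply: (bigmin_inf (x, y)) => //=.
by rewrite xC yC.
Qed.

Lemma min_dist_attained C : C != 0%VS ->
  exists x y, [/\ x \in C, y \in C, x != y & min_dist C = hamming_dist x y].
Proof.
rewrite -vpick0 => v0; rewrite /min_dist.
rewrite (bigmin_eq_arg _ (vpick C, 0)) /=; last 2 first.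
- by rewrite memv_pick mem0v.
- by move=> p _; rewrite leEnat (leq_trans (max_card _)) ?card_ord.
case: arg_minP => [|[x y] /and3P[xC yC xy] _].
  by rewrite /= memv_pick mem0v.
by exists x, y.
Qed.

Lemma ghw_min D D' : (D' <= D)%VS -> (ghw D (\dim D') <= #|supp_code D'|)%N.
Proof.
by move=> sD; rewrite /ghw -leEnat; apply: (bigmin_inf D'); rewrite ?sD /=.
Qed.

Lemma ghw_attained D i : (i <= \dim D)%N ->
  exists D', [/\ (D' <= D)%VS, \dim D' = i & ghw D i = #|supp_code D'|].
Proof.
move=> le_i.
have [U sU dU] : exists2 U : {vspace 'rV[F]_n}, (U <= D)%VS & \dim U = i.
  pose X := take i (vbasis D).
  have fX : free X.
    have := basis_free (vbasisP D).
    by rewrite -{1}(cat_take_drop i (vbasis D)) => /catl_free.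
  exists <<X>>%VS; last by rewrite (eqP fX) size_takel // size_tuple.
  apply/span_subvP => u /mem_take; exact: vbasis_mem.
rewrite /ghw (bigmin_eq_arg _ U); last 2 first.
- by rewrite sU dU eqxx.
- by move=> W _; rewrite leEnat (leq_trans (max_card _)) ?card_ord.
case: arg_minP => [|W /andP[sW /eqP dW] _]; first by rewrite sU dU eqxx.
by exists W.
Qed.

End Codes.

Lemma ceil_divnP (a d : nat) : (0 < d)%N ->
  forall q, (ceil_divn a d <= q)%N = (a <= q * d)%N.
Proof.
move=> d0 q; rewrite /ceil_divn; case: (boolP (d %| a)%N) => [dv|ndv] /=.
  by rewrite addn0 leq_divLR.
rewrite addn1 ltn_divLR // ltn_neqAle andb_idl // => _.
by apply: contraNneq ndv => ->; exact: dvdn_mull.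
Qed.

(* Main.v *)
(** A set of [m] independent words of weight at most [r + 1] whose supports cover
    [s] points contains a word with at least [ceil (2s / m) - (r + 1)] private
    points, since every non-private point is counted at least twice.  Discarding
    such words one at a time, starting from [b] of them, gives the bounds [e_m].
    For the minimum distance, enlarge the support of a subcode of the dual that
    attains [d_l] to [k + l - 1] coordinates: some nonzero codeword of [C]
    vanishes on all of them.  The integer [l] exists and is unique because
    [e_m - m] is nondecreasing, starts at [0] and ends at [n - b >= k]. *)
Require Import Defs.
From mathcomp Require Import all_boot all_order all_algebra.
From mathcomp Require Import zify.

Set Implicit Arguments.
Unset Strict Implicit.
Unset Printing Implicit Defensive.

Import GRing.Theory.

(** * Ceilings and private points *)

Lemma ceil_divn_ge (a d : nat) : 0 < d -> a <= ceil_divn a d * d.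
Proof. by move=> d0; rewrite -ceil_divnP. Qed.

Lemma ceil_divn_lt (a d : nat) : 0 < d -> ceil_divn a d * d < a + d.
Proof.
move=> d0; case c: (ceil_divn a d) => [|q]; first by lia.
by have : ~~ (ceil_divn a d <= q) by [rewrite c ltnn]; rewrite ceil_divnP //; lia.
Qed.

Lemma ceil_divn_double_le (s m : nat) : 2 <= m -> ceil_divn (2 * s) m <= s.
Proof. by move=> m2; rewrite ceil_divnP; nia. Qed.

(** As [m] is at least 2, [2 * s / m] grows no faster than [s]. Hence an upper bound on the size of
    a covered set survives a step of the recursion. *)
Lemma ceil_divn_double_mono (s t m : nat) : 2 <= m -> s <= t ->
  s - ceil_divn (2 * s) m <= t - ceil_divn (2 * t) m.
Proof.
move=> m2 st; have ct := ceil_divn_double_le t m2.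
have cs := @ceil_divn_ge (2 * s) m (ltnW m2).
suff: ceil_divn (2 * t) m <= t - s + ceil_divn (2 * s) m by lia.
by rewrite ceil_divnP; nia.
Qed.

Lemma exists_removable_set (I T : finType) (A : I -> {set T}) (J : {set I})
    (w : nat) : (forall i, i \in J -> #|A i| <= w) -> 0 < #|J| ->
  exists2 i, i \in J &
    #|\bigcup_(j in J :\ i) A j|
      + ceil_divn (2 * #|\bigcup_(j in J) A j|) #|J|
    <= #|\bigcup_(j in J) A j| + w.
Proof.
move=> Aw J0; set U := \bigcup_(j in J) A j.
pose V i := \bigcup_(j in J :\ i) A j.
have VU i : V i \subset U.
  apply/bigcupsP => j /setD1P[_ jJ]; exact: (bigcup_sup j).
have cardVU i : #|V i| + #|U :\: V i| = #|U|.
  by rewrite -(cardsID (V i) U) (setIidPr (VU i)).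
have cardE (B : {set T}) : B \subset U -> #|B| = \sum_(t in U) (t \in B).
  move=> BU; rewrite -sum1_card [RHS]big_mkcond [LHS]big_mkcond /=.
  apply: eq_bigr => t _; case: ifP => [/(subsetP BU)->//|_].
  by case: ifP.
(* A point lying in [A i] only is counted once in [A i] and once in
   [U :\: V i]; every other point is counted at least twice in the [#|A i|]. *)
have double : 2 * #|U| <= \sum_(i in J) (#|A i| + #|U :\: V i|).
  have -> : \sum_(i in J) (#|A i| + #|U :\: V i|)
      = \sum_(i in J) \sum_(t in U) ((t \in A i) + (t \in U :\: V i)).
    apply: eq_bigr => i iJ.
    by rewrite big_split /= -!cardE ?subsetDl //; exact: (bigcup_sup i).
  rewrite exchange_big /= mulnC -sum_nat_const; apply: leq_sum => t tU.
  have /bigcupP[i iJ tAi] := tU.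
  rewrite (bigD1 i) //= tAi inE tU andbT.
  case: (boolP (t \in V i)) => [/bigcupP[j /setD1P[ji jJ] tAj]|_] //=.
  by rewrite (bigD1 j) /= ?jJ // tAj; lia.
have /card_gt0P[i0 i0J] := J0.
(* [P i] counts the private points of [A i]. An index maximizing it does at least as well as the
   average given by [double]. *)
pose P i := #|U :\: V i|.
case: (@arg_maxnP _ i0 (mem J) P i0J) => i iJ imax.
exists i => //; rewrite -/(V i).
suff: ceil_divn (2 * #|U|) #|J| <= w + P i.
  by have := cardVU i; rewrite /P; lia.
rewrite ceil_divnP // (leq_trans double) // mulnC -sum_nat_const.
by apply: leq_sum => j jJ; apply: leq_add; [exact: Aw|exact: imax].
Qed.

(** * Bases, duals and supports of codes *)

Lemma free_subseq (K : fieldType) (vT : vectType K) (X Y : seq vT) :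
  subseq X Y -> free Y -> free X.
Proof.
move=> sXY fY; have /(subseq_uniqP (free_uniq fY)) -> := sXY.
exact: filter_free.
Qed.

(** The basis is picked among the generators, so a weight bound on these carries over to it. *)
Lemma span_basis_subseq (K : fieldType) (vT : vectType K) (X : seq vT) :
  exists Y, [/\ subseq Y X, free Y & (<<Y>> = <<X>>)%VS].
Proof.
elim: X => [|x X [Y [sYX fY eYX]]]; first by exists [::]; rewrite nil_free.
have [xY|xNY] := boolP (x \in <<Y>>%VS).
- exists Y; split=> //; first exact: subseq_trans sYX (subseq_cons _ _).
  by rewrite span_cons -eYX; apply/esym/addv_idPr; rewrite -memvE.
- exists (x :: Y); rewrite /= eqxx free_cons xNY fY; split=> //.
  by rewrite !span_cons eYX.
Qed.

Section Codes.
Variables (F : finFieldType) (n : nat).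
Implicit Types (C D : {vspace 'rV[F]_n}) (X : seq 'rV[F]_n).

Local Open Scope ring_scope.

Lemma supp_code_span_sub X (U : {set 'I_n}) :
  (forall x, x \in X -> supp x \subset U) -> supp_code <<X>>%VS \subset U.
Proof.
move=> XU; apply/bigcupsP => v vX; apply/subsetP => i.
rewrite inE; apply: contraNT => iNU.
rewrite (coord_span (X := in_tuple X) vX) summxE big1 // => j _.
rewrite mxE; apply/eqP; rewrite mulf_eq0; apply/orP; right.
have /XU/subsetP/(_ i) : X`_j \in X by apply: mem_nth.
by rewrite inE => /contraR /(_ iNU).
Qed.

Lemma dual_orthogonal C c d : c \in C -> d \in dual C -> \sum_i d 0 i * c 0 i = 0.
Proof. by move=> cC /mem_dual; apply. Qed.

Lemma row_free_basis D :
  row_free (\matrix_(i < \dim D) ((vbasis D)`_i : 'rV[F]_n)).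
Proof.
apply: inj_row_free => v; rewrite mulmx_sum_row => v0.
have /freeP fD := basis_free (vbasisP D).
apply/rowP => i; rewrite mxE; apply: (fD (fun i => v 0 i)).
by rewrite -[RHS]v0; apply: eq_bigr => j _; rewrite rowK.
Qed.

(** A basis matrix of [dual D] times the transpose of one of [D] is zero, so their ranks add up to
    at most [n]. *)
Lemma dim_dual_le D : (\dim D + \dim (dual D) <= n)%N.
Proof.
pose M (E : {vspace 'rV[F]_n}) :=
  \matrix_(i < \dim E) ((vbasis E)`_i : 'rV[F]_n).
have rM E : \rank (M E) = \dim E by apply/eqP; exact: row_free_basis.
have vbE (E : {vspace 'rV[F]_n}) (i : 'I_(\dim E)) : (vbasis E)`_i \in E.
  by apply/vbasis_mem/mem_nth; rewrite size_tuple.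
have /mulmx0_rank_max : M (dual D) *m (M D)^T = 0.
  apply/matrixP => i j; rewrite !mxE.
  rewrite -[RHS](dual_orthogonal (vbE D j) (vbE (dual D) i)).
  by apply: eq_bigr => l _; rewrite !mxE.
by rewrite mxrank_tr !rM addnC.
Qed.

(** Encoded as the kernel of the projection onto the coordinates in [S], so that rank-nullity bounds
    its dimension from below. *)
Definition vanishing (S : {set 'I_n}) : {vspace 'rV[F]_n} :=
  lker (linfun (mulmxr (colsub (enum_val : 'I_#|S| -> 'I_n) 1%:M)
                 : 'rV[F]_n -> 'rV[F]_#|S|)).

Lemma vanishingP (S : {set 'I_n}) (v : 'rV[F]_n) :
  reflect (forall i, i \in S -> v 0 i = 0) (v \in vanishing S).
Proof.
rewrite memv_ker lfunE /= mulmx_colsub mulmx1; apply: (iffP eqP).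
- move=> /rowP v0 i iS; have := v0 (enum_rank_in iS i).
  by rewrite !mxE enum_rankK_in.
- by move=> v0; apply/rowP => j; rewrite !mxE v0 // enum_valP.
Qed.

Lemma dim_vanishing_ge (S : {set 'I_n}) : (n - #|S| <= \dim (vanishing S))%N.
Proof.
set f := linfun (mulmxr (colsub (enum_val : 'I_#|S| -> 'I_n) 1%:M)
                 : 'rV[F]_n -> 'rV[F]_#|S|).
have := limg_ker_dim f fullv; have := dimvS (subvf (limg f)).
rewrite capfv !dimvf /dim /= !mul1n => h1 h2.
by rewrite leq_subLR -/f; apply: leq_trans (leq_add h1 (leqnn _)); rewrite addnC h2.
Qed.

(* [C] and the words vanishing on [S] both lie in the dual of [D], so they are
   too large to meet trivially. *)
Lemma exists_codeword_vanishing C D (S : {set 'I_n}) :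
    (D <= dual C)%VS -> supp_code D \subset S ->
    (#|S| < \dim C + \dim D)%N -> (#|S| <= n)%N ->
  exists c, [/\ c \in C, c != 0 & forall i, i \in S -> c 0 i = 0].
Proof.
move=> DC DS Slt Sn.
have sub : (C + vanishing S <= dual D)%VS.
  rewrite subv_add; apply/andP; split; apply/subvP => v vP;
    apply/mem_dual => d dD.
  - rewrite -[RHS](dual_orthogonal vP (subvP DC d dD)).
    by apply: eq_bigr => i _; rewrite mulrC.
  - rewrite big1 // => i _; have [iS|iNS] := boolP (i \in S).
      by move/vanishingP: vP => -> //; rewrite mul0r.
    suff -> : d 0 i = 0 by rewrite mulr0.
    apply/eqP; apply: contraNT iNS => di; apply: (subsetP DS).
    by apply/bigcupP; exists d; rewrite ?inE.
have := dimv_sum_cap C (vanishing S).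
have := dimvS sub; have := dim_dual_le D; have := dim_vanishing_ge S => *.
have : (C :&: vanishing S)%VS != 0%VS by rewrite -dimv_eq0; lia.
rewrite -vpick0 => c0; exists (vpick (C :&: vanishing S)).
have := memv_pick (C :&: vanishing S); rewrite memv_cap => /andP[cC /vanishingP].
by split.
Qed.

Lemma min_dist_le_vanishing C c (S : {set 'I_n}) :
    c \in C -> c != 0 -> (forall i, i \in S -> c 0 i = 0) ->
  (min_dist C <= n - #|S|)%N.
Proof.
move=> cC c0 cS; apply: leq_trans (min_dist_min cC (mem0v C) c0) _.
have -> : (n - #|S| = #|~: S|)%N by have := cardsC S; rewrite card_ord; lia.
apply: subset_leq_card; apply/subsetP => i; rewrite !inE.
by apply: contraNN => iS; rewrite cS // mxE.
Qed.

Lemma min_dist_le_of_dual_subcode C D (s : nat) :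
    (D <= dual C)%VS -> (#|supp_code D| <= s)%N ->
    (s < \dim C + \dim D)%N -> (s <= n)%N ->
  (min_dist C <= n - s)%N.
Proof.
move=> DC Ds slt sn.
have [S DS cS] : exists2 S : {set 'I_n}, supp_code D \subset S & #|S| = s.
  elim: {slt} s sn Ds => [|s IH] sn.
    by rewrite leqn0 => /eqP D0; exists (supp_code D).
  rewrite leq_eqVlt => /orP[/eqP|]; first by exists (supp_code D).
  move=> /(IH (ltnW sn)) [S DS cS].
  have /card_gt0P[i] : (0 < #|~: S|)%N.
    by have := cardsC S; rewrite card_ord; lia.
  rewrite inE => iNS; exists (i |: S); last by rewrite cardsU1 iNS cS.
  by apply: subset_trans DS _; exact: subsetUr.
rewrite -cS in slt sn *.
have [c [cC c0 cv]] := exists_codeword_vanishing DC DS slt sn.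
exact: min_dist_le_vanishing cC c0 cv.
Qed.

Lemma low_weight_dual_sub C r : (low_weight_dual C r <= dual C)%VS.
Proof. by apply/span_subvP => c; rewrite mem_enum inE => /andP[]. Qed.

Lemma low_weight_dual_basis C r : exists Y : seq 'rV[F]_n,
  [/\ free Y, (<<Y>> = low_weight_dual C r)%VS
    & forall y, y \in Y -> (#|supp y| <= r + 1)%N].
Proof.
have [Y [sY fY eY]] := span_basis_subseq
  (enum [set c : 'rV[F]_n | (c \in dual C) && (#|supp c| <= r + 1)%N]).
exists Y; split=> // y /(mem_subseq sY).
by rewrite mem_enum inE => /andP[].
Qed.

(** By locality the supports of a low-weight basis cover all coordinates, each at most [r + 1] of
    them. This yields [b <= \dim B0], so that the weights up to index [b] are genuine minima. *)
Lemma locality_length_le C r : all_symbol_locality C r ->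
  (n <= \dim (low_weight_dual C r) * (r + 1))%N.
Proof.
move=> locC; have [Y [fY eY wY]] := low_weight_dual_basis C r.
rewrite -eY (eqP fY).
have covered : [set: 'I_n] \subset \bigcup_(j < size Y) supp Y`_j.
  apply: subset_trans (supp_code_span_sub (X := Y) _); last first.
    by move=> y /(nthP 0)[j jY <-]; exact: (bigcup_sup (Ordinal jY)).
  apply/subsetP => i _; have [h [hC ih wh]] := locC i.
  apply/bigcupP; exists h => //; rewrite eY.
  by apply: memv_span; rewrite mem_enum inE hC.
have := subset_leq_card covered; rewrite cardsT card_ord => /leq_trans; apply.
have -> : (size Y * (r + 1) = \sum_(j < size Y) (r + 1))%N.
  by rewrite sum_nat_const card_ord.
elim/big_ind2: _ => [|p A q B Ap Bq|j _]; first by rewrite cards0.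
  exact: leq_trans (leq_card_setU A B) (leq_add Ap Bq).
exact/wY/mem_nth.
Qed.

Lemma ghw_span_subfamily D Y b (J : {set 'I_b}) :
    free Y -> (<<Y>> <= D)%VS -> (b <= size Y)%N ->
  (ghw D #|J| <= #|\bigcup_(j in J) supp Y`_j|)%N.
Proof.
move=> fY YD bY; pose X := [seq Y`_(nat_of_ord j) | j in J].
have sX : subseq X Y.
  apply: (@subseq_trans _ (take b Y)); last exact: take_subseq.
  have -> : take b Y = [seq Y`_(nat_of_ord j) | j : 'I_b].
    apply: (@eq_from_nth _ 0); first by rewrite size_map size_enum_ord size_takel.
    move=> j; rewrite size_takel // => jb.
    rewrite nth_take // (nth_map (Ordinal jb)) ?size_enum_ord //.
    by rewrite nth_enum_ord.
  by apply: map_subseq; rewrite enumT; exact: filter_subseq.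
have dX : \dim <<X>>%VS = #|J|.
  by rewrite (eqP (free_subseq sX fY)) size_map -cardE.
have XD : (<<X>> <= D)%VS.
  by apply: subv_trans YD; apply: sub_span; exact: mem_subseq.
rewrite -dX; apply: leq_trans (ghw_min XD) _.
apply/subset_leq_card/supp_code_span_sub => x /imageP[j jJ ->].
exact: (bigcup_sup j).
Qed.

(** Serves the case [l = 0] of the distance bound, since the bounds by [e m] start at [m = 1]. *)
Lemma ghw0_le D : (ghw D 0 <= 0)%N.
Proof.
have := ghw_min (sub0v D); rewrite dimv0 => /leq_trans; apply.
rewrite leqn0 cards_eq0 -subset0; apply/bigcupsP => c.
rewrite memv0 => /eqP ->; apply/subsetP => i.
by rewrite !inE mxE eqxx.
Qed.

End Codes.

(** * Growth of the sequence [e] *)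

Section Recursion.
Variables (n r b : nat) (e : nat -> nat).
Hypotheses (bE : b = ceil_divn n (r + 1)) (eb : e b = n).
Hypothesis erec : forall m, 2 <= m <= b ->
  e (m - 1) = e m - ceil_divn (2 * e m) m + (r + 1).

Lemma recursionS m : 1 <= m < b ->
  e m = e m.+1 - ceil_divn (2 * e m.+1) m.+1 + (r + 1).
Proof. by move=> mb; rewrite -erec ?subn1 //; lia. Qed.

(* The second bound makes [e (m - 1) < e m]; when [r = 0] it is not preserved
   by the recursion on its own, but then it follows from the first one. *)
Lemma recursion_bounds m : 1 <= m <= b ->
  m <= e m /\ (2 <= m -> m * (r + 1) < 2 * e m).
Proof.
have [d] := ubnP (b - m); elim: d m => // d IH m dE /andP[m1 mb].
have [mlt|mge] := ltnP m b; last first.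
  have -> : m = b by lia.
  have b_le : b <= n by rewrite bE ceil_divnP ?addn1 // leq_pmulr.
  have : b * (r + 1) < n + (r + 1) by rewrite bE ceil_divn_lt ?addn1.
  rewrite eb; split=> //; nia.
have [||le_e lt_e] := IH m.+1; try lia.
rewrite recursionS; last by lia.
have m2 : 2 <= m.+1 by lia.
have := lt_e m2; have := ceil_divn_double_le (e m.+1) m2.
have := @ceil_divn_lt (2 * e m.+1) m.+1 isT.
have : ceil_divn (2 * e m.+1) m.+1 <= e m.+1 + r + 1 - m.
  by rewrite ceil_divnP //; nia.
move: (ceil_divn _ _) => c; move: (e m.+1) {lt_e} le_e => s le_s h1 h2 h3 h4.
have h5 : m <= s - c + (r + 1) by lia.
split=> // mge2; case: (posnP r) => [r0|r0]; first by rewrite r0; lia.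
(* The factor [m.+1] lets the bound [c * m.+1 < 2 * s + m.+1] apply. Together with [m - 1] times the
   induction hypothesis it leaves a slack of [m.+1 * r], positive here. *)
suff: m.+1 * (2 * c + m * (r + 1)) < m.+1 * (2 * (s + r + 1)).
  by rewrite ltn_mul2l /=; lia.
have : (m.+1 * (r + 1) + 1) * (m - 1) <= 2 * s * (m - 1).
  by rewrite leq_mul2r addn1 h4 orbT.
have -> : m = (m - 2).+2 by lia.
nia.
Qed.

(** For positive [m], the second of the [recursion_bounds] makes the ceiling subtracted exceed the
    [r + 1] added back. *)
Lemma recursion_lt m : e 0 = 0 -> m < b -> e m < e m.+1.
Proof.
move=> e0 mb; have [|le_e lt_e] := @recursion_bounds m.+1; first by lia.
have [->|m0] := posnP m; first by rewrite e0; have [] := @recursion_bounds 1; lia.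
rewrite recursionS; last by lia.
have := ceil_divn_double_le (e m.+1) (m := m.+1).
have := @ceil_divn_ge (2 * e m.+1) m.+1 isT; have := lt_e m0.
move=> h1 h2 /(_ m0) h3.
have : m.+1 * (r + 1) < m.+1 * ceil_divn (2 * e m.+1) m.+1 by lia.
by rewrite ltn_mul2l /=; lia.
Qed.

(** Strict growth of integers means steps of at least 1. The additive form avoids truncated
    subtraction. *)
Lemma recursion_diff_mono i j : e 0 = 0 -> i <= j <= b -> e i + j <= e j + i.
Proof.
move=> e0 /andP[]; elim: j => [|j IH]; first by rewrite leqn0 => /eqP ->.
rewrite leq_eqVlt => /orP[/eqP -> //|ij] jb.
have := recursion_lt e0 jb; have := IH ij (ltnW jb); lia.
Qed.
End Recursion.

Theorem mainTheorem3
  (F : finFieldType) (n k r : nat) (C : {vspace 'rV[F]_n})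
  (dimC : \dim C = k) (locC : all_symbol_locality C r)
  (b : nat) (bE : b = ceil_divn n (r + 1))
  (e : nat -> nat) (e0 : e 0 = 0) (eb : e b = n)
  (erec : forall m, 2 <= m <= b ->
     e (m - 1) = e m - ceil_divn (2 * e m) m + (r + 1)) :
  let B0 := low_weight_dual C r in
  [/\ b <= \dim B0,
      forall m, 1 <= m <= b -> ghw B0 m <= e m,
      0 < k -> exists! l, l < b /\ e l < k + l < e (l + 1)
    & forall l, l < b -> e l < k + l < e (l + 1) ->
        min_dist C <= n + 1 - (k + l)].
Proof.
move=> B0.
have b_le : b <= \dim B0.
  by rewrite bE ceil_divnP; [exact: locality_length_le | rewrite addn1].
have ghw_le m : 1 <= m <= b -> ghw B0 m <= e m.
  have [Y [fY eY wY]] := low_weight_dual_basis C r.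
  have bY : b <= size Y by rewrite -(eqP fY) eY.
  pose U (J : {set 'I_b}) := \bigcup_(j in J) supp (Y`_j)%R.
  suff ex_J m' : 1 <= m' <= b -> exists2 J : {set 'I_b}, #|J| = m' & #|U J| <= e m'.
    move=> /ex_J[J <- UJ]; apply: leq_trans UJ.
    by apply: ghw_span_subfamily; rewrite // eY.
  (* Downward induction on the number of words kept, starting from all [b] of them, which cover at
     most [n = e b] points. *)
  have [d] := ubnP (b - m'); elim: d m' => // d IH {}m dE /andP[m1 mb].
  have [mlt|mge] := ltnP m b; last first.
    exists [set: 'I_b]; first by rewrite cardsT card_ord; lia.
    have -> : m = b by lia.
    by rewrite eb (leq_trans (max_card _)) ?card_ord.
  have [||J cJ UJ] := IH m.+1; try lia.
  have [||i iJ] := @exists_removable_set _ _ (fun j : 'I_b => supp (Y`_j)%R) J (r + 1).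
  - by move=> j _; apply/wY/mem_nth; exact: leq_trans (ltn_ord j) bY.
  - by rewrite cJ.
  rewrite -/(U J) -/(U (J :\ i)) cJ => Ui.
  exists (J :\ i); first by apply/eqP; rewrite -eqSS -cJ (cardsD1 i J) iJ.
  rewrite (recursionS erec); last by lia.
  have := ceil_divn_double_mono (m := m.+1) m1 UJ.
  have := ceil_divn_double_le #|U J| (m := m.+1) m1; lia.
have mono := recursion_diff_mono bE eb erec e0.
split=> //.
- move=> k0.
  (* The index [b] qualifies: [b <= \dim B0 <= \dim (dual C) <= n - k]. *)
  have ek : exists j, k + j <= e j.
    exists b; rewrite eb; have := dim_dual_le C.
    have := dimvS (low_weight_dual_sub C r); rewrite -/B0 dimC; lia.
  (* The least such index is positive since [k > 0]; its predecessor is [l]. *)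
  case: (ex_minnP ek) => -[|l]; first by rewrite e0; lia.
  move=> kl lmin; have lb : l < b.
    apply: lmin; rewrite eb; have := dim_dual_le C.
    have := dimvS (low_weight_dual_sub C r); rewrite -/B0 dimC; lia.
  have el : e l < k + l by rewrite ltnNge; apply/negP => /lmin; rewrite ltnn.
  exists l; split=> [|l' [lb']]; first by rewrite addn1 el; split=> //; lia.
  rewrite addn1 => /andP[h1 h2].
  (* Past the smaller index [e j - j] is at least [k] and stays so, but it is below [k] at the
     larger one. *)
  have [ll|ll|//] := ltngtP l l'.
  + by have := mono l.+1 l'; lia.
  + by have := mono l'.+1 l; lia.
- move=> l lb /andP[h1 h2].
  have [D [DB dD gD]] := @ghw_attained F n B0 l (leq_trans (ltnW lb) b_le).
  have Dl : #|supp_code D| <= e l.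
    rewrite -gD; have [->|l0] := posnP l; first by rewrite e0 ghw0_le.
    by apply: ghw_le; rewrite l0 ltnW.
  have kn : k + l < n by have := mono (l + 1) b; rewrite eb; lia.
  have k0 : 0 < k by have := mono 0 l; rewrite e0; lia.
  (* The set to vanish on gets [k + l - 1] points: at least [e l], and the most allowed below
     [\dim C + \dim D = k + l]. *)
  have -> : n + 1 - (k + l) = n - (k + l).-1 by lia.
  apply: (@min_dist_le_of_dual_subcode _ _ _ D); rewrite ?dimC ?dD; try lia.
  exact: subv_trans DB (low_weight_dual_sub C r).
Qed.
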